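(* Let $G=(V,E)$ be a finite, simple, connected, undirected graph. Then: (1) for every $(x,y)\in V^2$, the game $\Gamma^G_{(x,y)}$ has a value $\widehat v^G_{(x,y)}$, i.e. $\inf_{\widetilde\pi_C}\sup_{\widetilde\pi_R} v^G_{(x,y)}(\widetilde\pi_C,\widetilde\pi_R)=\sup_{\widetilde\pi_R}\inf_{\widetilde\pi_C} v^G_{(x,y)}(\widetilde\pi_C,\widetilde\pi_R)$ (possibly $+\infty$); (2) there exists a memoryless cop strategy $\widetilde\pi_C^*$ which is optimal for every game $\Gamma^G_{(x,y)}$, $(x,y)\in V^2$, and for every $\varepsilon>0$ there exists a memoryless robber strategy $\widetilde\pi_R^\varepsilon$ which is $\varepsilon$-optimal for every game $\Gamma^G_{(x,y)}$, $(x,y)\in V^2$; (3) $V^2$ is partitioned into $V_1=\{(x,y):\widehat v^G_{(x,y)}<\infty\}$ and $V_2=\{(x,y):\widehat v^G_{(x,y)}=\infty\}$; (4) if $c(G)=1$, then $V_1=V^2$, i.e. $\widehat v^G_{(x,y)}<\infty$ for every $(x,y)\in V^2$.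
   Context: For a node $u$, $N[u]$ denotes the closed neighborhood of $u$. $c(G)$ is the classical cop number of $G$ (the minimum number of cops that can guarantee capture of the robber in the classical turn-based cops and robber game on $G$, where players alternate moves, cops first, each token moving within the closed neighborhood of its node, and capture means a cop and the robber share a node). $\Gamma^G_{(x_0,y_0)}$ denotes the concurrent cops and robber game on $G$ with one cop and one robber starting at cop location $x_0$ and robber location $y_0$: in each round $t=1,2,\dots$ the cop (player $C$) and robber (player $R$) simultaneously choose moves $u,v\in V$ and the new position is $(x_t,y_t)=\widetilde Q((x_{t-1},y_{t-1}),u,v)$, where $\widetilde Q$ is: if $x=y$ then $\widetilde Q((x,y),u,v)=(x,x)$; if $x\ne y$, a move $u\notin N[x]$ is ignored (cop stays at $x$) and a move $v\notin N[y]$ is ignored (robber stays at $y$); if $x\ne y$, $u\in N[x]$, $v\in N[y]$, $u=y$ and $v=x$ then the new position is $(u,u)$ (en passant capture); otherwise the new position is $(u,v)$ with the ignored-move convention. Both players know all past positions. A (randomized) strategy is a map assigning to each finite history of positions a probability distribution on $V$ for the next move; it is memoryless if this distribution depends only on the current position. The payoff (paid by $C$ to $R$) is $v^G_{(x_0,y_0)}(\widetilde\pi_C,\widetilde\pi_R)=\mathbb{E}\left(\sum_{t=0}^\infty r(x_t,y_t)\right)$, where $r(x,y)=1$ if $x\ne y$ and $r(x,y)=0$ if $x=y$; $R$ maximizes and $C$ minimizes. The value $\widehat v^G_{(x,y)}$ is the common quantity $\inf_{\widetilde\pi_C}\sup_{\widetilde\pi_R}v=\sup_{\widetilde\pi_R}\inf_{\widetilde\pi_C}v$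 when these coincide. For $\varepsilon\ge0$, a cop strategy $\widetilde\pi_C$ is $\varepsilon$-optimal for $\Gamma^G_{(x,y)}$ if $|\widehat v^G_{(x,y)}-\sup_{\widetilde\pi_R}v^G_{(x,y)}(\widetilde\pi_C,\widetilde\pi_R)|\le\varepsilon$, and a robber strategy $\widetilde\pi_R$ is $\varepsilon$-optimal if $|\widehat v^G_{(x,y)}-\inf_{\widetilde\pi_C}v^G_{(x,y)}(\widetilde\pi_C,\widetilde\pi_R)|\le\varepsilon$; $0$-optimal means optimal.
   Formalization: Where the value is infinite, |v−w| ≤ ε is undefined (and requiring an infinite robber guarantee fails for some graphs), so ε-optimal is taken there to mean that the guaranteed payoff is at least 1/ε (infinite when ε = 0). *)

(* Defs.v *)
From HB Require Import structures.
From mathcomp Require Import all_boot all_order all_algebra.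
From mathcomp Require Import all_classical all_reals all_analysis.

Set Implicit Arguments.
Unset Strict Implicit.
Unset Printing Implicit Defensive.

Import Order.TTheory GRing.Theory Num.Theory.
Import numFieldNormedType.Exports.

Local Open Scope classical_set_scope.
Local Open Scope ring_scope.

(** * Graphs *)

Record sgraph := SGraph {
  vertex :> finType;
  adj : rel vertex;
  vertex_nonempty : (0 < #|vertex|)%N;
  adj_sym : symmetric adj;
  adj_irr : irreflexive adj }.

Definition connected_graph (G : sgraph) : Prop :=
  forall x y : G, connect (@adj G) x y.

Definition cl_nbhd (G : sgraph) (x : G) : {set G} :=
  [set y | (y == x) || adj x y].

(** * The classical game and the cop number *)

(* A deterministic strategy of k cops with perfect information: [s ys] is the
   placement of the cops after the robber has shown the locations [ys] (in
   chronological order), so [s [::]] is the initial placement.  The cops' own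
   past locations are determined by [s] and [ys]. *)
Definition classical_strategy (G : sgraph) (k : nat) :=
  seq G -> {ffun 'I_k -> G}.

Definition classical_legal (G : sgraph) k (s : classical_strategy G k) : Prop :=
  forall ys y i, s (rcons ys y) i \in cl_nbhd (s ys i).

Definition robber_walk (G : sgraph) (w : nat -> G) : Prop :=
  forall t, w t.+1 \in cl_nbhd (w t).

(* [s (mkseq w t)] is the placement of the cops when the robber arrives at
   [w t], and [s (mkseq w t.+1)] their placement after their reply. *)
Definition classical_capture (G : sgraph) k (s : classical_strategy G k)
    (w : nat -> G) : Prop :=
  exists t i, s (mkseq w t) i = w t \/ s (mkseq w t.+1) i = w t.

Definition cops_win (G : sgraph) (k : nat) : Prop :=
  exists2 s : classical_strategy G k, classical_legal s &
    forall w, robber_walk w -> classical_capture s w.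

Lemma cops_win_card (G : sgraph) : exists k, `[< cops_win G k >].
Proof.
exists #|G|; apply/asboolP; exists (fun _ => [ffun i => enum_val i]).
  by move=> ys y i; rewrite inE eqxx.
by move=> w _; exists 0%N, (enum_rank (w 0%N)); left; rewrite ffunE enum_rankK.
Qed.

Definition cop_number (G : sgraph) : nat := ex_minn (cops_win_card G).

(** * The concurrent game *)

Definition next_position (G : sgraph) (p : G * G) (u v : G) : G * G :=
  let: (x, y) := p in
  if x == y then (x, x)
  else if [&& u \in cl_nbhd x, v \in cl_nbhd y, u == y & v == x] then (u, u)
  else (if u \in cl_nbhd x then u else x, if v \in cl_nbhd y then v else y).

Record fdist (R : realType) (A : finType) := FDist {
  fdist_fun :> {ffun A -> R};
  fdist_ge0 : forall a, 0 <= fdist_fun a;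
  fdist_sum1 : \sum_a fdist_fun a = 1 }.

(* A nonempty history of positions is given as the list of its past positions
   (in chronological order) followed by the current one. *)
Definition strategy (R : realType) (G : sgraph) :=
  seq (G * G) -> G * G -> fdist R G.

Definition memoryless (R : realType) (G : sgraph) (s : strategy R G) : Prop :=
  forall h h' p, s h p = s h' p.

(* Conditional probability that the next position is [q]; the two players
   randomize independently. *)
Definition step_prob (R : realType) (G : sgraph) (sC sR : strategy R G)
    (h : seq (G * G)) (p q : G * G) : R :=
  \sum_(u : G) \sum_(v : G | next_position p u v == q) sC h p u * sR h p v.

(* Conditional probability that [qs] are the next [size qs] positions. *)
Fixpoint path_prob (R : realType) (G : sgraph) (sC sR : strategy R G)
    (h : seq (G * G)) (p : G * G) (qs : seq (G * G)) : R :=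
  if qs is q :: qs' then
    step_prob sC sR h p q * path_prob sC sR (rcons h p) q qs'
  else 1.

(** * The law of the play *)

Definition play (G : sgraph) : Type := nat -> G * G.

(* Measurable spaces are pointed types in the library. *)
HB.instance Definition _ (G : sgraph) := Choice.on (play G).
HB.instance Definition _ (G : sgraph) :=
  let x := enum_val (Ordinal (vertex_nonempty G)) in
  isPointed.Build (play G) (fun=> (x, x)).

Definition cylinder (G : sgraph) (ps : seq (G * G)) : set (play G) :=
  [set w | mkseq w (size ps) = ps].

Definition play_space (G : sgraph) :=
  g_sigma_algebraType (range (@cylinder G)).

(* Existence of the law of the play (Ionescu-Tulcea): the unit interval is
   successively subdivided into intervals of lengths [path_prob _ _ _ _ _]. *)
Section IonescuTulcea.
Variables (R : realType) (G : sgraph) (sC sR : strategy R G).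

Local Notation pos := (G * G)%type.
Local Notation step := (step_prob sC sR).
Implicit Types (h : seq pos) (p q : pos) (a l w : R).

Lemma step_prob_ge0 h p q : 0 <= step h p q.
Proof.
apply: sumr_ge0 => u _; apply: sumr_ge0 => v _.
by apply: mulr_ge0; exact: fdist_ge0.
Qed.

Lemma step_prob_sum1 h p : \sum_q step h p q = 1.
Proof.
rewrite exchange_big /= -[RHS](fdist_sum1 (sC h p)); apply: eq_bigr => u _.
transitivity (\sum_v sC h p u * sR h p v).
  rewrite (exchange_big_dep predT) //=; apply: eq_bigr => v _.
  by rewrite (big_pred1 (next_position p u v)) // => q; rewrite eq_sym.
by rewrite -big_distrr /= fdist_sum1 mulr1.
Qed.

Lemma path_prob_ge0 h p qs : 0 <= path_prob sC sR h p qs.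
Proof.
elim: qs h p => [|q qs IH] h p //=.
by rewrite mulr_ge0 // step_prob_ge0.
Qed.

Let cut h p a l (k : nat) : R :=
  a + l * \sum_(q | (enum_rank q < k)%N) step h p q.

Let cutS h p a l q :
  cut h p a l (enum_rank q).+1 =
  cut h p a l (enum_rank q) + l * step h p q.
Proof.
rewrite /cut (bigD1 q) //= -addrA -mulrDr [step h p q + _]addrC.
congr (_ + _ * (_ + _)); apply: eq_bigl => r.
rewrite ltnS [RHS]ltn_neqAle andbC; congr (_ && _).
by rewrite (inj_eq val_inj) (inj_eq enum_rank_inj).
Qed.

Let cut_le h p a l i j : 0 <= l -> (i <= j)%N ->
  cut h p a l i <= cut h p a l j.
Proof.
move=> l0 ij; rewrite lerD2l ler_wpM2l //.
rewrite [leRHS](bigID (fun q => (enum_rank q < i)%N)) /=.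
rewrite [X in _ <= X + _](eq_bigl (fun q => (enum_rank q < i)%N)).
  by rewrite lerDl sumr_ge0 // => q _; exact: step_prob_ge0.
move=> q /=; case: (ltnP (enum_rank q) i) => qi; last by rewrite andbF.
  by rewrite (leq_trans qi ij).
Qed.

Let block h p a l q (w : R) :=
  (cut h p a l (enum_rank q) <= w < cut h p a l (enum_rank q) + l * step h p q).

Let block_exists h p a l w : a <= w < a + l -> exists q, block h p a l q w.
Proof.
move=> /andP[aw wal].
have c0 : cut h p a l 0 = a.
  by rewrite /cut big_pred0 ?mulr0 ?addr0.
have cn : cut h p a l #|{: pos}| = a + l.
  rewrite /cut (eq_bigl predT) ?step_prob_sum1 ?mulr1 // => q.
  by rewrite ltn_ord.
suff H n : (n <= #|{: pos}|)%N -> w < cut h p a l n ->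
    exists q, block h p a l q w.
  by apply: (H _ (leqnn _)); rewrite cn.
elim: n => [|n IH] nN; first by rewrite c0 ltNge aw.
move=> wn; have [wn'|nw] := ltP w (cut h p a l n); first exact: IH (ltnW nN) _.
exists (enum_val (Ordinal nN)).
by rewrite /block -cutS enum_valK /= nw.
Qed.

Let block_uniq h p a l w q r : 0 <= l ->
  block h p a l q w -> block h p a l r w -> q = r.
Proof.
move=> l0; rewrite /block -!cutS => /andP[q1 q2] /andP[r1 r2].
apply/enum_rank_inj/val_inj/eqP; rewrite eqn_leq; apply/andP; split.
  rewrite leqNgt; apply/negP => rq.
  have := lt_le_trans r2 (le_trans (cut_le h p a l0 rq) q1).
  by rewrite ltxx.
rewrite leqNgt; apply/negP => rq.
have := lt_le_trans q2 (le_trans (cut_le h p a l0 rq) r1).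
by rewrite ltxx.
Qed.

Let block_sub h p a l w q : 0 <= l -> block h p a l q w -> a <= w < a + l.
Proof.
move=> l0; rewrite /block -cutS => /andP[q1 q2]; apply/andP; split.
  apply: le_trans q1; rewrite /cut lerDl mulr_ge0 // sumr_ge0 // => r _.
  exact: step_prob_ge0.
apply: (lt_le_trans q2); apply: le_trans (cut_le h p a l0 (ltn_ord _)) _.
rewrite /cut (eq_bigl predT) ?step_prob_sum1 ?mulr1 // => r.
by rewrite ltn_ord.
Qed.

Let nxt h p a l w : pos := odflt p [pick q | block h p a l q w].

Fixpoint coded_play w h p a l (n : nat) : pos :=
  if n is m.+1 then
    let q := nxt h p a l w in
    coded_play w (rcons h p) q
      (cut h p a l (enum_rank q)) (l * step h p q) m
  else p.

Fixpoint coded_left h p a l (qs : seq pos) : R :=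
  if qs is q :: qs' then
    coded_left (rcons h p) q (cut h p a l (enum_rank q)) (l * step h p q) qs'
  else a.

Let coded_sub h p a l qs w : 0 <= l ->
  coded_left h p a l qs <= w < coded_left h p a l qs + l * path_prob sC sR h p qs ->
  a <= w < a + l.
Proof.
elim: qs h p a l => [|q qs IH] h p a l l0 /=; first by rewrite mulr1.
rewrite mulrA => /IH H; apply: (@block_sub h p _ _ _ q) => //.
by apply: H; rewrite mulr_ge0 // step_prob_ge0.
Qed.

Let coded_playP h p a l qs w : 0 <= l -> a <= w < a + l ->
  (mkseq (coded_play w h p a l) (size qs).+1 = p :: qs) <->
  (coded_left h p a l qs <= w <
     coded_left h p a l qs + l * path_prob sC sR h p qs).
Proof.
elim: qs h p a l => [|q qs IH] h p a l l0 wa; first by rewrite /= mulr1.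
have -> : mkseq (coded_play w h p a l) (size (q :: qs)).+1 =
   p :: mkseq (fun n => coded_play w h p a l n.+1) (size qs).+1.
  rewrite /mkseq -[(size (q :: qs)).+1]/(1 + (size qs).+1)%N iotaD map_cat /=.
  by rewrite -[in iota 2 _](addn1 1) iotaDl -map_comp.
have [q0 bq0] := block_exists h p wa.
have nx : nxt h p a l w = q0.
  rewrite /nxt; case: pickP => [r br|/(_ q0)]; last by rewrite bq0.
  exact: block_uniq br bq0.
have l1 r : 0 <= l * step h p r by rewrite mulr_ge0 // step_prob_ge0.
rewrite [X in _ :: X](_ : _ = mkseq (coded_play w (rcons h p) q0
   (cut h p a l (enum_rank q0)) (l * step h p q0)) (size qs).+1); last first.
  by apply: eq_mkseq => n /=; rewrite nx.
rewrite [coded_left _ _ _ _ (q :: qs)]/= [path_prob _ _ _ _ (q :: qs)]/= mulrA.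
have [<-|qq] := eqVneq q0 q.
  split; first by case=> H; apply/IH => //; rewrite /mkseq /= H.
  by move/IH => ->.
split; first by case => /eqP; rewrite (negbTE qq).
move=> H; move/(coded_sub (l1 q)) : (H) => bq.
by rewrite (block_uniq l0 bq0 bq) eqxx in qq.
Qed.

Let mnormalize1E d (T : measurableType d) (mu : {measure set T -> \bar R})
    (P : probability T R) A : mu setT = 1%E -> mnormalize mu P A = mu A.
Proof. by move=> mu1; rewrite /mnormalize mu1 onee_eq0 /= invr1 mule1. Qed.

Theorem play_law_exists (p0 : pos) :
  exists P : probability (play_space G) R,
    forall qs, P (cylinder (p0 :: qs)) = (path_prob sC sR [::] p0 qs)%:E.
Proof.
pose D : set (measurableTypeR R) := `[0, 1[%classic.
have mD : measurable D by exact: measurable_itv.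
pose X (w : measurableTypeR R) : play_space G :=
  if w \in D then coded_play w [::] p0 0 1 else fun=> p0.
have XD w : D w -> X w = coded_play w [::] p0 0 1.
  by move=> Dw; rewrite /X mem_set.
have DP w : D w <-> ((0 : R) <= w < 0 + 1) by rewrite /D /= in_itv /= add0r.
have preD qs : X @^-1` (cylinder (p0 :: qs)) `&` D =
    `[coded_left [::] p0 0 1 qs,
      coded_left [::] p0 0 1 qs + path_prob sC sR [::] p0 qs[%classic.
  apply/seteqP; split => w /=; rewrite in_itv /=.
    move=> [+ Dw]; rewrite /cylinder /= XD //.
    by move/coded_playP; rewrite mul1r => -> //; apply/DP.
  rewrite -[path_prob _ _ _ _ _]mul1r => H.
  have w01 := coded_sub ler01 H; split; last exact/DP.
  rewrite /cylinder /= XD; last exact/DP.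
  by apply/coded_playP.
have preD0 q qs : q != p0 -> X @^-1` (cylinder (q :: qs)) `&` D = set0.
  move=> qp; rewrite -subset0 => w /= [+ Dw]; rewrite /cylinder /= XD //.
  by rewrite /mkseq /= => -[/esym/eqP]; rewrite (negbTE qp).
have preC (A : set (play G)) : X @^-1` A `&` ~` D =
    if (fun=> p0) \in A then ~` D else set0.
  case: ifPn => [/set_mem Ap|/negP Ap]; apply/seteqP; split => w //=.
  - by case.
  - by move=> Dw; split => //; rewrite /X memNset.
  - by move=> [+ Dw]; rewrite /X memNset // => Aw; apply: Ap; exact/mem_set.
have mX : measurable_fun (setT : set (measurableTypeR R)) X.
  have := @measurability _ _ _ _ setT X (range (@cylinder G)).
  apply; first by [].
  move=> _ [_ [ps _ <-] <-]; rewrite setTI.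
  rewrite -(setIT (_ @^-1` _)) -(setUv D) setIUr; apply: measurableU; last first.
    by rewrite preC; case: ifPn => _ //; exact: measurableC.
  case: ps => [|q qs].
    by rewrite (_ : X @^-1` _ = setT) ?setTI // -subTset.
  have [->|qp] := eqVneq q p0; first by rewrite preD; exact: measurable_itv.
  by rewrite preD0.
pose U := mnormalize (mrestr (@lebesgue_measure R) mD) point.
have DE : mrestr (@lebesgue_measure R) mD setT = 1%E.
  by rewrite /mrestr setTI lebesgue_measure_itv /= lte_fin ltr01 sube0.
have UE A : U A = lebesgue_measure (A `&` D).
  by rewrite /U mnormalize1E.
pose Y : {mfun measurableTypeR R >-> play_space G} :=
  HB.pack X (isMeasurableFun.Build _ _ _ _ X mX).
exists (distribution U Y) => qs.
transitivity (U (X @^-1` cylinder (p0 :: qs))); first by [].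
rewrite UE preD lebesgue_measure_itv /= lte_fin ltrDl.
rewrite lt_neqAle path_prob_ge0 andbT.
case: eqP => [<- //|_] /=.
by rewrite -EFinD addrAC subrr add0r.
Qed.

End IonescuTulcea.

(* The law of the play started at [p0]: it is the only probability measure with
   the property below, as the cylinders form a generating pi-system. *)
Definition play_law (R : realType) (G : sgraph) (sC sR : strategy R G)
    (p0 : G * G) : probability (play_space G) R :=
  projT1 (cid (play_law_exists sC sR p0)).

Lemma play_lawE (R : realType) (G : sgraph) (sC sR : strategy R G)
    (p0 : G * G) (qs : seq (G * G)) :
  play_law sC sR p0 (cylinder (p0 :: qs)) =
  (path_prob sC sR [::] p0 qs)%:E.
Proof. by rewrite /play_law; case: cid => P /= ->. Qed.

(** * Payoff, value and optimality *)

Definition round_payoff (R : realType) (G : sgraph) (p : G * G) : R :=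
  (p.1 != p.2)%:R.

Local Open Scope ereal_scope.

Definition payoff (R : realType) (G : sgraph) (sC sR : strategy R G)
    (p0 : G * G) : \bar R :=
  \int[play_law sC sR p0]_w \sum_(0 <= t <oo) (round_payoff R (w t))%:E.

Definition cop_guarantee (R : realType) (G : sgraph) (sC : strategy R G)
    (p0 : G * G) : \bar R :=
  ereal_sup [set payoff sC sR p0 | sR in [set: strategy R G]].

Definition robber_guarantee (R : realType) (G : sgraph) (sR : strategy R G)
    (p0 : G * G) : \bar R :=
  ereal_inf [set payoff sC sR p0 | sC in [set: strategy R G]].

Definition upper_value (R : realType) (G : sgraph) (p0 : G * G) : \bar R :=
  ereal_inf [set cop_guarantee sC p0 | sC in [set: strategy R G]].

Definition lower_value (R : realType) (G : sgraph) (p0 : G * G) : \bar R :=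
  ereal_sup [set robber_guarantee sR p0 | sR in [set: strategy R G]].

Definition has_value (R : realType) (G : sgraph) (p0 : G * G) : Prop :=
  upper_value R p0 = lower_value R p0.

(* Only meaningful when [has_value R p0]. *)
Definition value (R : realType) (G : sgraph) (p0 : G * G) : \bar R :=
  upper_value R p0.

(* [`|v - w| <= eps] for a finite value [v].  For [v = +oo] the difference is
   meaningless, and we take the usual convention that [w] must be at least
   [1 / eps] (that is [+oo] when [eps = 0]).  Requiring [w = +oo] for all [eps]
   would be too much: let G be the 4-cycle 0-4-6-5, the edge 5-3 and the
   triangle 3-1-2, with the cop at 3 and the robber at 1.  The value is [+oo],
   but every memoryless robber strategy has a finite guarantee: with the cop at
   3 and the robber at 1 or 2, the cop waits if the robber goes to 3 with
   positive probability, and otherwise tries the more likely of 1 and 2 and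
   goes back to 3 if it misses. *)
Definition eps_close (R : realType) (eps : R) (v w : \bar R) : Prop :=
  if v == +oo then eps%:E^-1 <= w else `|v - w| <= eps%:E.

Definition cop_eps_optimal (R : realType) (G : sgraph) (eps : R)
    (sC : strategy R G) (p0 : G * G) : Prop :=
  eps_close eps (value R p0) (cop_guarantee sC p0).

Definition robber_eps_optimal (R : realType) (G : sgraph) (eps : R)
    (sR : strategy R G) (p0 : G * G) : Prop :=
  eps_close eps (value R p0) (robber_guarantee sR p0).

Definition finite_positions (R : realType) (G : sgraph) : set (G * G) :=
  [set p | value R p < +oo].

Definition infinite_positions (R : realType) (G : sgraph) : set (G * G) :=
  [set p | value R p = +oo].

Arguments finite_positions R G : clear implicits.
Arguments infinite_positions R G : clear implicits.

(* Main.v *)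
(* With [val p w] the value of the matrix game played at [p] when the next
   position [q] is worth [w q], iterate [w 0 = 0] and
   [w (n + 1) p = r p + b n * val p (w n)], where [b n < 1] increases to 1.  The
   sequence [w] is nondecreasing, and the value of the concurrent game is its
   supremum [V].

   Robber: his optimal mixed moves in the matrix games for [w n] form a
   memoryless strategy with [w n <= r + b n * E (w n)] against every cop move.
   As [b n < 1] and [r >= 0], it guarantees [w n] in the undiscounted game, and
   [w n] is eps-close to [V] at all of the finitely many positions for large [n].

   Cop: by compactness of the simplex, his optimal mixed moves in the matrix
   games for [w n] have a cluster point, for which [r + E V <= V] against every
   robber move; hence it guarantees [V].

   When one cop wins the classical game, a cop moving uniformly at random guesses
   with probability at least [1 / #|G|] the reply that decreases the rank of the
   position in the classical game, whatever the robber does at the same time.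
   This gives a finite potential that bounds the expected capture time. *)

Require Import Defs.
From HB Require Import structures.
From mathcomp Require Import all_boot all_order all_algebra.
From mathcomp Require Import all_classical all_reals all_analysis.
From mathcomp Require Import measurable_realfun ring lra.

Set Implicit Arguments.
Unset Strict Implicit.
Unset Printing Implicit Defensive.

Import Order.TTheory GRing.Theory Num.Theory.
Import numFieldNormedType.Exports.

Local Open Scope classical_set_scope.
Local Open Scope ring_scope.

(** * Finite matrix games *)

Section MatrixGames.
Variable R : realType.

Definition mean (A : finType) (s : fdist R A) (f : A -> R) : R :=
  \sum_a s a * f a.

Lemma mean_le (A : finType) (s : fdist R A) (f g : A -> R) :
  (forall a, f a <= g a) -> mean s f <= mean s g.
Proof.
by move=> fg; apply: ler_sum => a _; rewrite ler_wpM2l // fdist_ge0.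
Qed.

Lemma mean_cst (A : finType) (s : fdist R A) (c : R) : mean s (fun=> c) = c.
Proof. by rewrite /mean -big_distrl /= fdist_sum1 mul1r. Qed.

Lemma meanD (A : finType) (s : fdist R A) (f g : A -> R) :
  mean s (fun a => f a + g a) = mean s f + mean s g.
Proof. by rewrite /mean -big_split; apply: eq_bigr => a _; rewrite mulrDr. Qed.

Lemma meanZ (A : finType) (s : fdist R A) (c : R) (f : A -> R) :
  mean s (fun a => c * f a) = c * mean s f.
Proof. by rewrite /mean big_distrr; apply: eq_bigr => a _; rewrite mulrCA. Qed.

Lemma mean_exchange (A B : finType) (s : fdist R A) (t : fdist R B)
    (f : A -> B -> R) :
  mean s (fun a => mean t (f a)) = mean t (fun b => mean s (f^~ b)).
Proof.
rewrite /mean; under eq_bigr do rewrite big_distrr /=.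
rewrite exchange_big; apply: eq_bigr => b _; rewrite big_distrr /=.
by apply: eq_bigr => a _; rewrite mulrCA.
Qed.

(** The points [x n] need only come close to [p] infinitely often, so no subsequence is extracted;
    an error [eps] in every weight costs at most [eps] times the sum of the absolute values of
    [f]. *)
Lemma frequently_close_sum_le (A : finType) (x : nat -> A -> R) (p : A -> R)
    (f : A -> R) (C : R) (m : nat) :
    (forall eps N, 0 < eps ->
       exists2 n, (N <= n)%N & forall a, `|x n a - p a| <= eps) ->
    (forall n, (m <= n)%N -> \sum_a x n a * f a <= C) ->
  \sum_a p a * f a <= C.
Proof.
move=> xp xC; apply/ler_addgt0Pr => e e0.
set K := 1 + \sum_a `|f a|.
have K0 : 0 < K by rewrite ltr_pwDl // sumr_ge0.
have [n mn xn] := xp (e / K) m (divr_gt0 e0 K0).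
apply: (@le_trans _ _ (\sum_a (x n a * f a + e / K * `|f a|))).
  apply: ler_sum => a _; rewrite -lerBlDl -mulrBl.
  apply: le_trans (ler_norm _) _; rewrite normrM distrC.
  by rewrite ler_wpM2r.
rewrite big_split /= lerD ?xC // -big_distrr /= mulrAC ler_pdivrMr //.
by rewrite ler_wpM2l ?(ltW e0) // /K lerDr.
Qed.

(** The weights lie in a compact cube. A cluster point there has total mass 1 because both bounds,
    [<= 1] and [>= 1], pass to the limit. *)
Lemma fdist_seq_cluster (A : finType) (s : nat -> fdist R A) :
  exists p : fdist R A, forall eps N, 0 < eps ->
    exists2 n, (N <= n)%N & forall a, `|s n a - p a| <= eps.
Proof.
pose x (n : nat) : 'rV[R]_#|A| := \row_i s n (enum_val i).
pose box := [set v : 'rV[R]_#|A| | forall i, `[0, 1]%classic (v ord0 i)].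
have cbox : compact box.
  apply: (@rV_compact R _ (fun=> `[0, 1]%classic)) => i.
  exact: segment_compact.
have xbox n : box (x n).
  move=> i; rewrite /x mxE /= in_itv /= fdist_ge0 /=.
  rewrite -(fdist_sum1 (s n)) (bigD1 (enum_val i)) //= lerDl sumr_ge0 //.
  by move=> a _; exact: fdist_ge0.
have [p [pbox clp]] : box `&` cluster (x @ \oo) !=set0.
  by apply: cbox; exists 0%N => // n _; exact: xbox.
pose q a := p ord0 (enum_rank a).
have xq eps N : 0 < eps ->
    exists2 n, (N <= n)%N & forall a, `|s n a - q a| <= eps.
  move=> e0.
  have [|v [[n Nn <-] pn]] := clp (x @` [set n | (N <= n)%N]) (ball p eps) _
    (nbhsx_ballx _ _ e0).
    by exists N => // n Nn; exists n.
  exists n => // a; have [_ /(_ ord0 (enum_rank a))] := pn.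
  rewrite /x mxE enum_rankK /ball /= => H; rewrite distrC; exact: ltW.
have q0 a : 0 <= [ffun a => q a] a.
  by rewrite ffunE; have := pbox (enum_rank a); rewrite /= in_itv /= => /andP[].
have q1 : \sum_a [ffun a => q a] a = 1.
  under eq_bigr do rewrite ffunE.
  apply/le_anti/andP; split.
    under eq_bigr do rewrite -[q _]mulr1.
    apply: (@frequently_close_sum_le A s q (fun=> 1) 1 0 xq) => n _.
    by rewrite -[leLHS]/(mean (s n) (fun=> 1)) mean_cst.
  rewrite -lerN2 -sumrN; under eq_bigr do rewrite -mulrN1.
  apply: (@frequently_close_sum_le A s q (fun=> -1) (-1) 0 xq) => n _.
  by rewrite -[leLHS]/(mean (s n) (fun=> -1)) mean_cst.
exists (FDist q0 q1) => eps N /(xq _ N)[n Nn nq]; exists n => // a.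
by rewrite /= ffunE.
Qed.

(** Constraint [m] is required only from stage [m] on, which is enough for a cluster point to
    satisfy all of them. *)
Lemma fdist_compact (A I : finType) (s : nat -> fdist R A) (f : nat -> I -> A -> R)
    (C : nat -> I -> R) :
  (forall m n i, (m <= n)%N -> mean (s n) (f m i) <= C m i) ->
  exists p : fdist R A, forall m i, mean p (f m i) <= C m i.
Proof.
move=> sC; have [p pP] := fdist_seq_cluster s.
exists p => m i.
exact: (@frequently_close_sum_le _ (fun n => s n) p _ _ m pP) (sC m ^~ i).
Qed.

(** * Constructions of distributions *)

Lemma fdist_normalize (A : finType) (g : A -> R) :
    (forall a, 0 <= g a) -> 0 < \sum_a g a ->
  exists s : fdist R A, forall f, mean s f = (\sum_a g a)^-1 * \sum_a g a * f a.
Proof.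
move=> g0 S0.
have q0 a : 0 <= [ffun a => g a / \sum_a g a] a.
  by rewrite ffunE divr_ge0 // ltW.
have q1 : \sum_a [ffun a => g a / \sum_a g a] a = 1.
  by under eq_bigr do rewrite ffunE; rewrite -big_distrl /= divff // gt_eqF.
exists (FDist q0 q1) => f; rewrite /mean big_distrr /=.
by apply: eq_bigr => a _; rewrite ffunE mulrAC mulrC mulrA.
Qed.

Lemma fdist_dirac (A : finType) (a0 : A) :
  exists s : fdist R A, forall f, mean s f = f a0.
Proof.
have H (f : A -> R) : \sum_a (a == a0)%:R * f a = f a0.
  rewrite (bigD1 a0) //= eqxx mul1r big1 ?addr0 // => a /negbTE ->.
  by rewrite mul0r.
have S : \sum_a (a == a0)%:R = 1 :> R.
  by rewrite -[RHS](H (fun=> 1)); apply: eq_bigr => a _; rewrite mulr1.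
have [//||s sP] := @fdist_normalize A (fun a => (a == a0)%:R).
  by rewrite S.
by exists s => f; rewrite sP S invr1 mul1r H.
Qed.

(** This is the mixture of [s] and the pure move [a0] with weight [t], written as a variation of [s]
    in the direction of [a0]. *)
Lemma fdist_conv (A : finType) (s : fdist R A) (a0 : A) (t : R) : 0 <= t <= 1 ->
  exists s' : fdist R A, forall f, mean s' f = mean s f + t * (f a0 - mean s f).
Proof.
move=> /andP[t0 t1].
have H (f : A -> R) : \sum_a ((1 - t) * s a + t * (a == a0)%:R) * f a =
    (1 - t) * mean s f + t * f a0.
  under eq_bigr do rewrite mulrDl -!mulrA.
  rewrite big_split /= -!big_distrr /=; congr (_ + _ * _).
  rewrite (bigD1 a0) //= eqxx mul1r big1 ?addr0 // => a /negbTE ->.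
  by rewrite mul0r.
have S : \sum_a ((1 - t) * s a + t * (a == a0)%:R) = 1.
  under eq_bigr do rewrite -[_ + _]mulr1.
  by rewrite H mean_cst; ring.
have [|| s' sP] := @fdist_normalize A (fun a => (1 - t) * s a + t * (a == a0)%:R).
- by move=> a; rewrite addr_ge0 // mulr_ge0 // ?subr_ge0 // fdist_ge0.
- by rewrite S.
by exists s' => f; rewrite sP S invr1 mul1r H; ring.
Qed.

Lemma matrix_bounded (U V : finType) (A : U -> V -> R) :
  exists K, forall u v, `|A u v| <= K.
Proof.
exists (\sum_u \sum_v `|A u v|) => u v.
rewrite (bigD1 u) //= (bigD1 v) //= -addrA lerDl addr_ge0 ?sumr_ge0 //.
by move=> *; rewrite sumr_ge0.
Qed.

(** * The minimax theorem *)

Let pos (x : R) : R := Num.max 0 x.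

Let pos_ge0 x : 0 <= pos x.
Proof. by rewrite /pos le_max lexx. Qed.

Let pos_mul x : pos x * x = pos x ^+ 2.
Proof.
rewrite /pos; case: (leP 0 x) => x0; first by rewrite expr2.
by rewrite mul0r expr0n.
Qed.

(** Expanding the right-hand side gives a second-order upper bound for the squared positive part,
    whose derivative at [a] is [2 * pos a]. *)
Let pos_sqrD a b : pos (a + b) ^+ 2 <= (pos a + b) ^+ 2.
Proof.
have [ab|ab] := leP 0 (a + b); last first.
  by rewrite /pos (max_idPl _) ?(ltW ab) // expr0n sqr_ge0.
rewrite /pos (max_idPr _) // lerXn2r ?nnegrE //; last first.
  by rewrite lerD2r le_max lexx orbT.
by apply: le_trans ab _; rewrite lerD2r le_max lexx orbT.
Qed.

(* For a near-minimiser [s] of the sum of the squares of the positive parts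
   of its payoffs, these positive parts, once normalized, are the weights of a
   strategy of the opponent. *)
Lemma approx_alternative (U V : finType) (A : U -> V -> R) (u0 : U) (eps : R) :
    0 < eps ->
  (exists s : fdist R U, forall v, mean s (A^~ v) <= eps) \/
  (exists t : fdist R V, forall u, 0 <= mean t (A u)).
Proof.
move=> e0; have [|nex] := pselect (exists s : fdist R U, forall v, mean s (A^~ v) <= eps).
  by left.
right.
pose F (s : fdist R U) := \sum_v pos (mean s (A^~ v)) ^+ 2.
have Fe s : eps ^+ 2 <= F s.
  have [v ev] : exists v, eps < mean s (A^~ v).
    apply: contrapT => H; apply: nex; exists s => v; rewrite leNgt.
    by apply/negP => ev; apply: H; exists v.
  rewrite /F (bigD1 v) //= -[leLHS]addr0 lerD ?sumr_ge0 //; last first.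
    by move=> *; rewrite sqr_ge0.
  rewrite lerXn2r ?nnegrE ?(ltW e0) ?pos_ge0 //.
  by rewrite /pos le_max (ltW ev) orbT.
pose I := inf (range F).
have FI s : I <= F s.
  apply: ge_inf; last by exists s.
  by exists (eps ^+ 2) => _ [s' _ <-].
have [s0 _] := fdist_dirac u0.
have [K AK] := matrix_bounded A.
have mK s v : `|mean s (A^~ v)| <= K.
  rewrite -(mean_cst s K); apply: le_trans (ler_norm_sum _ _ _) _.
  apply: ler_sum => u _; rewrite normrM ger0_norm ?fdist_ge0 //.
  by rewrite ler_wpM2l // fdist_ge0.
pose D : R := \sum_(v : V) (K + K) ^+ 2.
have D0 : 0 <= D by apply: sumr_ge0 => v _; rewrite sqr_ge0.
(* The step length towards the pure move [u]: the bound 1 makes the mixture convex, the other one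
   lets [eps ^+ 2] absorb both the slack [t ^+ 2] of near-minimality and the second-order term
   [t ^+ 2 * D]. *)
pose t := Num.min 1 (eps ^+ 2 / (1 + D)).
have e2 : 0 < eps ^+ 2 by rewrite exprn_gt0.
have t0 : 0 < t by rewrite lt_min ltr01 divr_gt0 // ltr_pwDl.
have t1 : t <= 1 by rewrite ge_min lexx.
have tD : t * (1 + D) <= eps ^+ 2.
  by rewrite -ler_pdivlMr ?ltr_pwDl // ge_min lexx orbT.
have [_ [s _ <-] sI] : exists2 x, range F x & x < I + t ^+ 2.
  apply: inf_lt; last by rewrite ltrDl exprn_gt0.
  by exists (F s0); exists s0.
pose g v := pos (mean s (A^~ v)).
have g0 v : 0 <= g v by exact: pos_ge0.
have gF : \sum_v g v * mean s (A^~ v) = F s.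
  by apply: eq_bigr => v _; exact: pos_mul.
have S0 : 0 < \sum_v g v.
  rewrite lt_neqAle sumr_ge0 // andbT; apply/eqP => /esym/psumr_eq0P H.
  have := Fe s; rewrite leNgt /F big1 ?e2 // => v _.
  by rewrite -/(g v) H // expr0n.
have [tau tauE] := fdist_normalize g0 S0.
exists tau => u; rewrite tauE mulr_ge0 ?invr_ge0 ?(ltW S0) //.
have [|s' s'E] := @fdist_conv _ s u t; first by rewrite ltW.
pose d v := A u v - mean s (A^~ v).
have Fs' : F s' <= F s + 2 * t * \sum_v g v * d v + t ^+ 2 * D.
  rewrite /F /D !big_distrr -!big_split /=; apply: ler_sum => v _.
  rewrite s'E -/(d v); apply: le_trans (pos_sqrD _ _) _; rewrite -/(g v).
  have : (d v) ^+ 2 <= (K + K) ^+ 2.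
    have K0 : 0 <= K by exact: le_trans (AK u v).
    rewrite -[leLHS]real_normK ?num_real // lerXn2r ?nnegrE ?addr_ge0 //.
    by apply: le_trans (ler_normB _ _) _; rewrite lerD.
  move=> /(ler_wpM2l (sqr_ge0 t)); move: (d v) (g v) => x y; lra.
(* Compare [I <= F s'] with [F s < I + t ^+ 2] and divide by [2 * t]. The loss [eps ^+ 2] is then
   compensated by [F s >= eps ^+ 2]. *)
have : - eps ^+ 2 <= \sum_v g v * d v.
  have := FI s'; move: sI Fs' tD t0 e2.
  move: (F s') (F s) (\sum_v _) => a b c; clear; nra.
rewrite /d; under eq_bigr do rewrite mulrBr.
by rewrite sumrB gF; have := Fe s; lra.
Qed.

(** The value is the infimum of what the minimiser can guarantee. Below it the first alternative of
    [approx_alternative] fails, so both players have near-optimal strategies, and compactness makes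
    them optimal. *)
Theorem minimax (U V : finType) (A : U -> V -> R) (u0 : U) (v0 : V) :
  exists c (s : fdist R U) (t : fdist R V),
    (forall v, mean s (A^~ v) <= c) /\ (forall u, c <= mean t (A u)).
Proof.
pose X := [set c | exists s : fdist R U, forall v, mean s (A^~ v) <= c].
have [K AK] := matrix_bounded A.
have X0 : has_inf X.
  split.
    have [s0 _] := fdist_dirac u0; exists K, s0 => v.
    rewrite -[leRHS](mean_cst s0); apply: mean_le => u.
    exact: le_trans (ler_norm _) (AK u v).
  exists (- K) => c [s /(_ v0)]; apply: le_trans.
  rewrite -[leLHS](mean_cst s); apply: mean_le => u.
  by have := AK u v0; rewrite ler_norml => /andP[].
have n0 n : 0 < n.+1%:R^-1 :> R by rewrite invr_gt0.
have [n|s sP] := @choice nat (fdist R U)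
    (fun n s => forall v, mean s (A^~ v) <= inf X + n.+1%:R^-1).
  have [|c [s sc] cX] := @inf_lt _ X (inf X + n.+1%:R^-1) (proj1 X0).
    by rewrite ltrDl.
  by exists s => v; apply: le_trans (sc v) (ltW cX).
(* With a shift of twice the tolerance, the first alternative would guarantee strictly less than
   [inf X]. *)
have [n|t tP] := @choice nat (fdist R V)
    (fun n t => forall u, inf X - 2 * n.+1%:R^-1 <= mean t (A u)).
  set c := inf X - _.
  have [[s' s'P]|[t tP]] :=
      @approx_alternative U V (fun u v => A u v + (- c)) u0 (n.+1%:R^-1) (n0 n).
    have /(ge_inf (proj2 X0)) : X (c + n.+1%:R^-1).
      by exists s' => v; have := s'P v; rewrite meanD mean_cst lerBlDl.
    move=> cX; exfalso; move: cX (n0 n); rewrite /c; move: (inf X) (n.+1%:R^-1).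
    by move=> a b; lra.
  by exists t => u; have := tP u; rewrite meanD mean_cst subr_ge0.
have anti m n : (m <= n)%N -> n.+1%:R^-1 <= m.+1%:R^-1 :> R.
  by move=> mn; rewrite lef_pV2 ?posrE // ler_nat ltnS.
have small (a b : R) : (forall n, a <= b + n.+1%:R^-1) -> a <= b.
  move=> H; apply/ler_addgt0Pr => e e0; have [n ne] := ltr_add_invr e0.
  by rewrite add0r in ne; apply: le_trans (H n) _; rewrite lerD2l ltW.
have [p pP] := @fdist_compact U V s (fun _ v u => A u v)
  (fun n _ => inf X + n.+1%:R^-1)
  (fun m n v mn => le_trans (sP n v) (lerD (lexx _) (anti _ _ mn))).
(* The factor turns the lower bounds into the upper bounds of [fdist_compact], and halves the error
   so that [small] applies. *)
have [m n u mn|q qP] := @fdist_compact V U t (fun _ u v => (- 2^-1) * A u v)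
  (fun n _ => - 2^-1 * inf X + n.+1%:R^-1).
  rewrite meanZ; move: (tP n u) (anti _ _ mn).
  by move: (inf X) (n.+1%:R^-1) (m.+1%:R^-1) => a b c; lra.
exists (inf X), p, q; split => [v|u]; first exact: small (pP^~ v).
suff : (- 2^-1) * mean q (A u) <= - 2^-1 * inf X by lra.
by apply: small => n; rewrite -meanZ.
Qed.

End MatrixGames.

(** * The payoff as a series *)

Section Payoff.
Variables (R : realType) (G : sgraph).
Local Notation pos := (G * G)%type.
Implicit Types (sC sR : strategy R G) (h : seq pos) (p q : pos).

(** The expectation is unfolded from the first round on, so that partial sums satisfy a one-step
    recursion suited to induction on the horizon. *)
Fixpoint round_mean sC sR (t : nat) h p : R :=
  if t is t'.+1 then
    \sum_q step_prob sC sR h p q * round_mean sC sR t' (rcons h p) q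
  else round_payoff R p.

Lemma round_payoff_ge0 p : 0 <= round_payoff R p.
Proof. exact: ler0n. Qed.

Lemma round_mean_ge0 sC sR t h p : 0 <= round_mean sC sR t h p.
Proof.
elim: t h p => [|t IH] h p /=; first exact: round_payoff_ge0.
by apply: sumr_ge0 => q _; rewrite mulr_ge0 // step_prob_ge0.
Qed.

Lemma step_mean sC sR h p (f : pos -> R) :
  \sum_q step_prob sC sR h p q * f q =
  mean (sC h p) (fun u => mean (sR h p) (fun v => f (next_position p u v))).
Proof.
rewrite /step_prob; under eq_bigr do rewrite big_distrl /=.
rewrite exchange_big; apply: eq_bigr => u _ /=.
under eq_bigr do rewrite big_distrl /=.
rewrite (exchange_big_dep predT) //= /mean big_distrr; apply: eq_bigr => v _ /=.
by rewrite (big_pred1 (next_position p u v)) ?mulrA.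
Qed.

Lemma partial_sum_round_meanS sC sR n h p :
  \sum_(0 <= t < n.+1) round_mean sC sR t h p =
  round_payoff R p + \sum_q step_prob sC sR h p q *
    \sum_(0 <= t < n) round_mean sC sR t (rcons h p) q.
Proof.
rewrite big_nat_recl //=; congr (_ + _).
by rewrite exchange_big; apply: eq_bigr => q _; rewrite big_distrr.
Qed.

Lemma big_tuple_cons (T : finType) (n : nat) (F : seq T -> R) :
  \sum_(s : n.+1.-tuple T) F s = \sum_x \sum_(s : n.-tuple T) F (x :: s).
Proof.
rewrite pair_big /=.
rewrite (reindex (fun z : T * n.-tuple T => [tuple of z.1 :: z.2])) //=.
exists (fun s : n.+1.-tuple T => (thead s, [tuple of behead s])) => [[x s] _|s _].
  by congr pair; apply/val_inj.
by rewrite [RHS]tuple_eta.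
Qed.

(** * From the integral to the series of expected round payoffs *)

Lemma measurable_cylinder (ps : seq pos) :
  measurable (cylinder ps : set (play_space G)).
Proof. by apply: sub_sigma_algebra; exists ps. Qed.

Lemma round_mean_path sC sR t h p :
  \sum_(qs : t.-tuple pos) path_prob sC sR h p qs * round_payoff R (last p qs) =
  round_mean sC sR t h p.
Proof.
elim: t h p => [|t IH] h p.
  rewrite (big_pred1 [tuple]) => [|s]; first by rewrite /= mul1r.
  by apply/esym/eqP; exact: tuple0.
rewrite (big_tuple_cons _ (fun qs => path_prob sC sR h p qs * round_payoff R (last p qs))).
rewrite /=; apply: eq_bigr => q _; rewrite -(IH (rcons h p) q) big_distrr /=.
by apply: eq_bigr => qs _; rewrite mulrA.
Qed.

Local Open Scope ereal_scope.

(** Starting at [p0] has probability 1, so a cylinder with another start lies in a null set. *)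
Lemma play_law_cylinder sC sR p0 p qs :
  play_law sC sR p0 (cylinder (p :: qs)) =
  ((p == p0)%:R * path_prob sC sR [::] p0 qs)%:E.
Proof.
have [->|pp0] := eqVneq p p0; first by rewrite play_lawE mul1r.
rewrite mul0r; apply/eqP; rewrite eq_le measure_ge0 andbT.
have m0 := measurable_cylinder [:: p0].
have c0 : play_law sC sR p0 (~` cylinder [:: p0]) = 0.
  by rewrite probability_setC // play_lawE /= subee.
rewrite -[leRHS]c0; apply: le_measure; rewrite ?inE //; first exact: measurable_cylinder.
  exact: measurableC.
move=> w; rewrite /cylinder /= => -[w0 _] [w0'].
by move: pp0; rewrite -w0 -w0' eqxx.
Qed.

(** Exactly one prefix of length [t.+1] matches [w]. This finite combination of indicators yields
    both measurability and the integral. *)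
Lemma round_indic (t : nat) (w : play_space G) :
  (round_payoff R (w t))%:E =
  \sum_(ps : t.+1.-tuple pos)
    (round_payoff R (last (w 0%N) ps))%:E * (\1_(cylinder ps) w)%:E.
Proof.
have wt : w \in (cylinder (mkseq w t.+1) : set (play_space G)).
  by apply/mem_set; rewrite /cylinder /mkset size_mkseq.
rewrite (bigD1 [tuple of mkseq w t.+1]) //= big1 ?adde0; last first.
  move=> ps psw; rewrite indicE memNset ?mule0 // /cylinder /= size_tuple => wps.
  by case/eqP: psw; apply/val_inj; rewrite /= -wps.
rewrite indicE wt mule1; congr (round_payoff R _)%:E.
by rewrite -[RHS]/(last (w 0%N) (mkseq w t.+1)) -nth_last size_mkseq nth_mkseq.
Qed.

Lemma integral_round sC sR p0 t :
  \int[play_law sC sR p0]_w (round_payoff R (w t))%:E =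
  (round_mean sC sR t [::] p0)%:E.
Proof.
pose f (ps : seq pos) : R := round_payoff R (last p0 ps).
under eq_integral.
  move=> w _; rewrite round_indic.
  under eq_bigr => ps _.
    (* The tuple is nonempty, so the default of [last] is irrelevant and the coefficient no longer
       depends on [w]. *)
    rewrite (_ : last _ _ = last p0 ps); last by case: ps => -[].
    over.
  over.
rewrite ge0_integral_sum //; first last.
- by move=> ps w _; rewrite mule_ge0 ?lee_fin ?round_payoff_ge0.
- move=> ps; apply/measurable_EFinP/measurable_funM => //.
  by apply: measurable_indic; exact: measurable_cylinder.
under eq_bigr => ps _.
  rewrite ge0_integralZl_EFin ?round_payoff_ge0 //; last first.
    apply/measurable_EFinP/measurable_indic; exact: measurable_cylinder.
  rewrite integral_indic ?setIT //; last exact: measurable_cylinder.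
  over.
rewrite /= -round_mean_path.
pose c (ps : seq pos) : R :=
  (if ps is q :: qs then (q == p0)%:R * path_prob sC sR [::] p0 qs else 1)%R.
transitivity (\sum_(ps : t.+1.-tuple pos) (f ps * c ps)%:E).
  apply: eq_bigr => ps _; rewrite EFinM; congr (_ * _).
  case: ps => -[|q qs] //= _; exact: play_law_cylinder.
rewrite sumEFin (big_tuple_cons _ (fun ps => f ps * c ps)%R); congr EFin.
rewrite (bigD1 p0) //= [X in (_ + X)%R]big1 ?addr0.
  by apply: eq_bigr => qs _; rewrite /f eqxx mul1r mulrC.
by move=> q /negbTE q0; apply: big1 => qs _; rewrite q0 mul0r mulr0.
Qed.

Lemma payoffE sC sR p0 :
  payoff sC sR p0 = \sum_(0 <= t <oo) (round_mean sC sR t [::] p0)%:E.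
Proof.
rewrite /payoff integral_nneseries //.
- by apply: eq_eseriesr => t _; exact: integral_round.
- move=> t; apply: (eq_measurable_fun (fun w : play_space G =>
    \sum_(ps : t.+1.-tuple pos)
    (round_payoff R (last (w 0%N) ps))%:E * (\1_(cylinder ps) w)%:E)).
    by move=> w _; rewrite -round_indic.
  apply: emeasurable_sum => ps; case: ps => -[|q qs] //= i.
  apply/measurable_EFinP/measurable_funM => //.
  by apply: measurable_indic; exact: measurable_cylinder.
- by move=> t w _; rewrite lee_fin round_payoff_ge0.
Qed.

Lemma payoff_le sC sR p0 (c : R) :
  (forall n, \sum_(0 <= t < n) round_mean sC sR t [::] p0 <= c)%R ->
  payoff sC sR p0 <= c%:E.
Proof.
move=> H; rewrite payoffE; apply: lime_le.
  by apply: is_cvg_nneseries => n _ _; rewrite lee_fin round_mean_ge0.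
by apply: nearW => n; rewrite sumEFin lee_fin.
Qed.

Lemma payoff_ge sC sR p0 n :
  (\sum_(0 <= t < n) round_mean sC sR t [::] p0)%:E <= payoff sC sR p0.
Proof.
rewrite payoffE -sumEFin; apply: nneseries_lim_ge => t _ _.
by rewrite lee_fin round_mean_ge0.
Qed.

End Payoff.

(** * Discounted value iteration *)

Section Value.
Variables (R : realType) (G : sgraph).
Local Notation pos := (G * G)%type.
Implicit Types (w : pos -> R) (p q : pos).

Definition discount (n : nat) : R := 1 - n.+1%:R^-1.

Lemma discount_ge0 n : 0 <= discount n.
Proof. by rewrite subr_ge0 invf_le1 // ler1n. Qed.

Lemma discount_lt1 n : discount n < 1.
Proof. by rewrite ltrBlDr ltrDl invr_gt0. Qed.

Lemma discount_le m n : (m <= n)%N -> discount m <= discount n.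
Proof. by move=> mn; rewrite lerD2l lerN2 lef_pV2 ?posrE // ler_nat ltnS. Qed.

(** The discounts tend to 1; for nonpositive [x] a single instance suffices. *)
Lemma le_of_discount m (x y : R) :
  (forall n, (m <= n)%N -> discount n * x <= y) -> x <= y.
Proof.
move=> H; apply/ler_addgt0Pr => e e0.
have [x0|x0] := leP x 0.
  apply: le_trans (_ : discount m * x <= _).
    have := discount_lt1 m; have := discount_ge0 m; move: (discount m) => d; nra.
  by apply: le_trans (H m (leqnn m)) _; rewrite lerDl ltW.
have [k xk] := ltr_add_invr (divr_gt0 e0 x0); rewrite add0r in xk.
have := H _ (leq_maxl m k).
have : (maxn m k).+1%:R^-1 <= k.+1%:R^-1 :> R.
  by rewrite lef_pV2 ?posrE // ler_nat ltnS leq_maxr.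
move=> /le_lt_trans/(_ xk); rewrite ltr_pdivlMr // /discount mulrBl mul1r.
by move: (_^-1 * x) => z; lra.
Qed.

Lemma value_iteration :
  exists (w : nat -> pos -> R) (s t : nat -> pos -> fdist R G),
  [/\ forall n p, 0 <= w n p,
      forall m n p, (m <= n)%N -> w m p <= w n p,
      forall n p v, round_payoff R p +
        discount n * mean (s n p) (fun u => w n (next_position p u v)) <=
        w n.+1 p &
      forall n p u, w n p <= round_payoff R p +
        discount n * mean (t n p) (fun v => w n (next_position p u v))].
Proof.
pose g0 : G := enum_val (Ordinal (vertex_nonempty G)).
have [[w p]|sol solP] := @choice ((pos -> R) * pos) (R * fdist R G * fdist R G)
    (fun wp cst =>
      (forall v, mean cst.1.2 (fun u => wp.1 (next_position wp.2 u v)) <= cst.1.1) /\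
      (forall u, cst.1.1 <= mean cst.2 (fun v => wp.1 (next_position wp.2 u v)))).
  have [c [s [t st]]] := minimax (fun u v => w (next_position p u v)) g0 g0.
  by exists (c, s, t).
pose val w p := (sol (w, p)).1.1.
(* Pit the robber's optimal move for [w] against the cop's optimal move for [w']. *)
have val_mono w w' p : (forall q, w q <= w' q) -> val w p <= val w' p.
  move=> ww'; have [_ wt] := solP (w, p); have [w's _] := solP (w', p).
  move: wt w's; rewrite /= -/(val w p) -/(val w' p).
  move: (sol (w, p)).2 (sol (w', p)).1.2 => t s wt w's.
  rewrite -(mean_cst s (val w p)); apply: le_trans (mean_le _ wt) _.
  rewrite mean_exchange -(mean_cst t (val w' p)); apply: mean_le => v.
  by apply: le_trans (w's v); apply: mean_le.
have val_ge0 w p : (forall q, 0 <= w q) -> 0 <= val w p.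
  move=> w0; have [H _] := solP (w, p); apply: le_trans (H g0).
  by rewrite -[leLHS](mean_cst (sol (w, p)).1.2); apply: mean_le.
pose w := fix w n : pos -> R := if n is m.+1
  then fun p => round_payoff R p + discount m * val (w m) p else fun=> 0.
have w0 n p : 0 <= w n p.
  elim: n p => [//|n IH] p /=.
  by rewrite addr_ge0 ?round_payoff_ge0 // mulr_ge0 ?discount_ge0 // val_ge0.
have wS n p : w n p <= w n.+1 p.
  elim: n p => [|n IH] p; first exact: w0.
  rewrite /= lerD2l ler_pM ?discount_ge0 ?discount_le ?val_ge0 //.
  exact: val_mono.
have wle m n p : (m <= n)%N -> w m p <= w n p.
  elim: n => [|n IH]; first by rewrite leqn0 => /eqP ->.
  rewrite leq_eqVlt => /predU1P[-> //|]; rewrite ltnS => /IH mn.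
  exact: le_trans mn (wS _ _).
exists w, (fun n p => (sol (w n, p)).1.2), (fun n p => (sol (w n, p)).2).
split => // n p u; have [sP tP] := solP (w n, p).
  by rewrite /= lerD2l ler_wpM2l ?discount_ge0 //; exact: sP.
(* Lowering the left side from [w n.+1] to [w n] leaves a single function and a single discount, an
   inequality that can be iterated. *)
apply: le_trans (wS n p) _ => /=.
by rewrite lerD2l ler_wpM2l ?discount_ge0 //; exact: tP.
Qed.

(** Real bounds [C] and finite stages [m] express [r + E V <= V] without infinite values; where [w]
    is unbounded there is nothing to prove. Elsewhere the discounted constraints pass to a cluster
    point, and letting the discount tend to 1 at fixed [m] removes it. *)
Lemma cop_limit (w : nat -> pos -> R) (s : nat -> pos -> fdist R G) :
    (forall n p, 0 <= w n p) ->
    (forall m n p, (m <= n)%N -> w m p <= w n p) ->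
    (forall n p v, round_payoff R p +
      discount n * mean (s n p) (fun u => w n (next_position p u v)) <=
      w n.+1 p) ->
  exists s' : pos -> fdist R G,
    forall p C, (forall n, w n p <= C) -> forall m v, round_payoff R p +
      mean (s' p) (fun u => w m (next_position p u v)) <= C.
Proof.
move=> w0 wle ws.
suff /choice[s' s'P] : forall p, exists s' : fdist R G,
    forall C, (forall n, w n p <= C) -> forall m v, round_payoff R p +
      mean s' (fun u => w m (next_position p u v)) <= C by exists s'.
move=> p; have [[C wC]|unb] := pselect (exists C, forall n, w n p <= C); last first.
  by exists (s 0%N p) => C wC; case: unb; exists C.
pose X := range (w ^~ p); pose S := sup X.
have wS n : w n p <= S.
  by apply: ub_le_sup; [exists C => _ [m _ <-]|exists n].
have [m n v mn|s' s'P] := @fdist_compact R G G (s ^~ p)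
    (fun m v u => discount m * w m (next_position p u v))
    (fun _ _ => S - round_payoff R p).
  rewrite meanZ lerBrDl; apply: le_trans (wS n.+1); apply: le_trans (ws n p v).
  rewrite lerD2l ler_pM ?discount_ge0 ?discount_le //.
    by rewrite -[leLHS](mean_cst (s n p)); apply: mean_le.
  by apply: mean_le => u; exact: wle.
exists s' => C' wC' m v.
have SC' : S <= C' by apply: ge_sup; [exists (w 0%N p), 0%N|move=> _ [n _ <-]].
apply: le_trans SC'; rewrite -lerBrDl; apply: (@le_of_discount m) => n mn.
have := s'P n v; rewrite meanZ; apply: le_trans.
by rewrite ler_wpM2l ?discount_ge0 //; apply: mean_le => u; exact: wle.
Qed.

(* A sum exceeding [C] at [q] by [eps] would contradict the induction
   hypothesis, so every partial sum is within [eps] of some [w m q]; no case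
   distinction on the boundedness of [w ^~ q] is needed. *)
Lemma cop_partial_sum_le (w : nat -> pos -> R) (s : pos -> fdist R G) :
    (forall m n p, (m <= n)%N -> w m p <= w n p) ->
    (forall n p, 0 <= w n p) ->
    (forall p C, (forall n, w n p <= C) -> forall m v, round_payoff R p +
      mean (s p) (fun u => w m (next_position p u v)) <= C) ->
  forall sR N h p C, (forall n, w n p <= C) ->
    \sum_(0 <= t < N) round_mean (fun _ p => s p) sR t h p <= C.
Proof.
move=> wle w0 sw sR; elim=> [|N IH] h p C wC.
  by rewrite big_nil; exact: le_trans (w0 0%N p) (wC _).
rewrite partial_sum_round_meanS.
pose K q := \sum_(0 <= t < N) round_mean (fun _ p => s p) sR t (rcons h p) q.
apply/ler_addgt0Pr => e e0.
have /choice[m mK] : forall q, exists m, K q - e < w m q.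
  move=> q; apply: contrapT => nex.
  have /(IH (rcons h p)) : forall n, w n q <= K q - e.
    by move=> n; rewrite leNgt; apply/negP => wn; apply: nex; exists n.
  by rewrite -/(K q); lra.
(* By monotonicity, one stage serves all the finitely many next positions. *)
pose M := \max_q m q.
have KM q : K q <= w M q + e.
  rewrite -lerBlDr (le_trans (ltW (mK q))) // wle //.
  exact: leq_bigmax.
rewrite -/K (step_mean _ _ _ _ K).
apply: (@le_trans _ _ (round_payoff R p + mean (s p) (fun u =>
  mean (sR h p) (fun v => w M (next_position p u v) + e)))).
  by rewrite lerD2l; apply: mean_le => u; apply: mean_le.
rewrite mean_exchange -lerBrDl -[leRHS](mean_cst (sR h p)).
apply: mean_le => v; rewrite meanD mean_cst.
by have := sw p C wC M v; lra.
Qed.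

Lemma robber_partial_sum_ge (w : pos -> R) (t : pos -> fdist R G) (b M : R) :
    0 <= b -> b <= 1 -> (forall p, 0 <= w p <= M) ->
    (forall p u, w p <= round_payoff R p +
      b * mean (t p) (fun v => w (next_position p u v))) ->
  forall sC n h p,
    w p <= \sum_(0 <= k < n) round_mean sC (fun _ p => t p) k h p + b ^+ n * M.
Proof.
move=> b0 b1 wM wt sC; elim=> [|n IH] h p.
  by rewrite big_nil add0r expr0 mul1r; have /andP[] := wM p.
rewrite partial_sum_round_meanS.
set K := fun q => \sum_(0 <= k < n) round_mean sC (fun _ p => t p) k (rcons h p) q.
rewrite -/(K _) (step_mean _ _ _ _ K) -addrA.
rewrite -[leLHS](mean_cst (sC h p)).
apply: (@le_trans _ _ (mean (sC h p) (fun u => round_payoff R p +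
  b * mean (t p) (fun v => w (next_position p u v))))).
  by apply: mean_le.
rewrite meanD mean_cst lerD2l exprS -mulrA -[X in _ <= _ + X](mean_cst (sC h p)).
rewrite -meanD; apply: mean_le => u.
rewrite -meanZ -[X in _ <= _ + X](mean_cst (t p)) -meanD; apply: mean_le => v.
have K0 : 0 <= K (next_position p u v).
  by apply: sumr_ge0 => k _; exact: round_mean_ge0.
apply: le_trans (ler_wpM2l b0 (IH (rcons h p) _)) _.
by rewrite mulrDr lerD2r ler_piMl.
Qed.

Lemma robber_payoff_ge (w : pos -> R) (t : pos -> fdist R G) (b : R) :
    0 <= b -> b < 1 -> (forall p, 0 <= w p) ->
    (forall p u, w p <= round_payoff R p +
      b * mean (t p) (fun v => w (next_position p u v))) ->
  forall sC p, ((w p)%:E <= payoff sC (fun _ p => t p) p)%E.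
Proof.
move=> b0 b1 w0 wt sC p.
have wM q : 0 <= w q <= \sum_q w q.
  by rewrite w0 (bigD1 q) //= lerDl sumr_ge0.
apply/lee_addgt0Pr => e e0.
have [n bn] : exists n, b ^+ n * (\sum_q w q) <= e.
  have : (fun n => b ^+ n * (\sum_q w q)) @ \oo --> 0.
    rewrite -[X in _ --> X](mul0r (\sum_q w q)); apply: cvgMl.
    by apply: cvg_expr; rewrite ger0_norm.
  move=> /cvgrPdist_le/(_ e e0)[n _ /(_ n (leqnn n))].
  by rewrite sub0r normrN => /(le_trans (ler_norm _)); exists n.
apply: le_trans (leeD (payoff_ge sC (fun _ p => t p) p n) (le_refl e%:E)).
rewrite -EFinD lee_fin.
apply: le_trans (robber_partial_sum_ge b0 (ltW b1) wM wt sC n [::] p) _.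
by rewrite lerD2l.
Qed.

End Value.

(** * Graphs of cop number one *)

Section OneCop.
Variable G : sgraph.
Local Notation pos := (G * G)%type.

(* The least fixpoint is the set of the positions, with the robber to move,
   that are won by a single cop in the classical game. *)
Definition cop_step (X : {set pos}) : {set pos} :=
  [set p : pos | (p.1 == p.2) ||
    [forall y in cl_nbhd p.2, exists x in cl_nbhd p.1, (x, y) \in X]].

Lemma cop_step_mono : {homo cop_step : X Y / X \subset Y}.
Proof.
move=> X Y /fintype.subsetP XY; apply/fintype.subsetP => p; rewrite !inE.
case: (_ == _) => //= /forall_inP H; apply/forall_inP => y /H /exists_inP[x xp xy].
by apply/exists_inP; exists x => //; exact: XY.
Qed.

Lemma diag_cop_win x : (x, x) \in fixset cop_step.
Proof. by rewrite -(fixsetK cop_step_mono) inE eqxx. Qed.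

(** Otherwise the robber has a start from which he can keep outside the fixpoint forever. The
    resulting walk is never captured, since captures lie on the diagonal. *)
Lemma cop_start_win : cops_win G 1 ->
  exists x0, forall y, exists2 x, x \in cl_nbhd x0 & (x, y) \in fixset cop_step.
Proof.
case=> s s_legal s_win; exists (s [::] ord0) => y0; apply: contrapT => nex.
(* The robber has just arrived at [y] and the cop is to move: no legal reply reaches the
   fixpoint. *)
pose evades ys y := forall x, x \in cl_nbhd (s ys ord0) -> (x, y) \notin fixset cop_step.
have /choice[f fP] : forall z : seq G * G, exists y, evades z.1 z.2 ->
    y \in cl_nbhd z.2 /\ evades (rcons z.1 z.2) y.
  move=> [ys y] /=; have [ev|nev] := pselect (evades ys y); last by exists y.
  have := ev _ (s_legal ys y ord0).
  rewrite -(fixsetK cop_step_mono) inE negb_or => /andP[_].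
  move=> /forall_inPn[y' yy' /exists_inPn H]; exists y' => _; split=> //.
pose z := fix z t := if t is t'.+1 then (rcons (z t').1 (z t').2, f (z t')) else ([::], y0).
pose w t := (z t).2.
have zw t : (z t).1 = mkseq w t.
  by elim: t => //= t ->; rewrite mkseqS.
have zev t : evades (z t).1 (z t).2.
  elim: t => [|t IH]; last by have [] := fP _ IH.
  by move=> x xs; apply/negP => xW; apply: nex; exists x.
have [|t [i sw]] := s_win w.
  by move=> t; have [] := fP _ (zev t).
have := zev t; rewrite zw -/(w t) => ev; move: sw; rewrite (ord1 i).
(* If the robber has stepped onto the cop, staying put reaches the diagonal; otherwise the cop's
   legal reply does. *)
case=> sw.
  by have := ev (w t); rewrite -{1}sw inE eqxx diag_cop_win => /(_ isT).
have := ev _ (s_legal (mkseq w t) (w t) ord0).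
by rewrite -mkseqS sw diag_cop_win.
Qed.

(** A location that wins against every robber location passes this property to its neighbours: from
    there the cop moves to it first. Connectedness spreads it to the whole graph. *)
Lemma cop_win_everywhere : connected_graph G -> cops_win G 1 ->
  fixset cop_step = [set: pos]%SET.
Proof.
move=> G_connected /cop_start_win[x0 x0P].
have stay x : (forall y, exists2 x', x' \in cl_nbhd x & (x', y) \in fixset cop_step) ->
    forall y, (x, y) \in fixset cop_step.
  move=> xP y; rewrite -(fixsetK cop_step_mono) inE; apply/orP; right.
  by apply/forall_inP => y' _; apply/exists_inP; exact: xP.
apply/setP => -[x y]; rewrite inE.
have /connectP[p pP ->] := G_connected x0 x.
elim: p x0 {x0P} (stay _ x0P) pP y => [|x1 p IH] x0 x0P /= => [_ y|]; first exact: x0P.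
move=> /andP[x01 pP]; apply: IH pP; apply: stay => y.
by exists x0 => //; rewrite inE adj_sym x01 orbT.
Qed.

(** * A potential for the uniformly random cop *)

Variable R : realType.

(** The distribution is chosen before [x], so the good reply [x] may depend on the robber's
    simultaneous move. *)
Lemma uniform_fdist : exists s : fdist R G, forall (x : G) (f : G -> R) (a d : R),
  (forall u, f u <= a) -> f x <= a - d * #|G|%:R -> mean s f <= a - d.
Proof.
have G0 : 0 < #|G|%:R :> R by rewrite ltr0n vertex_nonempty.
have [||s sE] := @fdist_normalize R G (fun=> 1) => //.
  by rewrite sumr_const.
exists s => x f a d fa fx.
rewrite sE sumr_const ler_pdivrMl // (bigD1 x) //=.
under eq_bigr do rewrite mul1r.
apply: (@le_trans _ _ (a - d * #|G|%:R + \sum_(u | u != x) a)).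
  by rewrite mul1r lerD // ler_sum.
rewrite addrAC -(@bigD1 _ _ _ _ x predT (fun=> a)) //= sumr_const.
by rewrite mulrBr [d * _]mulrC !mulr_natl.
Qed.

Lemma one_cop_potential : fixset cop_step = [set: pos]%SET ->
  exists (s : fdist R G) (phi : pos -> R), (forall p, 0 <= phi p) /\
    forall p v, round_payoff R p + mean s (fun u => phi (next_position p u v)) <= phi p.
Proof.
move=> FT; have [s sP] := uniform_fdist; set k := #|G|%:R in sP.
have k1 : 1 <= k by rewrite ler1n vertex_nonempty.
(* The recursion makes a correct guess, with weight [1 / k], outweigh all wrong ones: even if these
   cost the maximal potential [c M], the mean drops by 1. *)
pose c := fix c j : R := if j is i.+1 then k * (c i + 1) else 0.
have c0 j : 0 <= c j.
  by elim: j => //= j IH; rewrite mulr_ge0 ?addr_ge0 // (le_trans _ k1).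
have cS j : c j <= c j.+1.
  by rewrite /=; have := c0 j; move: (c j) => x; nra.
have cle i j : (i <= j)%N -> c i <= c j.
  elim: j => [|j IH]; first by rewrite leqn0 => /eqP ->.
  rewrite leq_eqVlt => /predU1P[-> //|]; rewrite ltnS => /IH ij.
  exact: le_trans ij (cS _).
pose M := #|{: pos}|.
pose phi p := c M - c (M - fix_order cop_step p)%N.
have phiM p : phi p <= c M by rewrite gerDl oppr_le0.
exists s, phi; split=> [p|[x y] v]; first by rewrite subr_ge0 cle ?leq_subr.
rewrite /round_payoff /=; case: (eqVneq x y) => [xy|xy] /=.
  by rewrite add0r mean_cst xy.
have rM : (fix_order cop_step (x, y) <= M)%N by exact: fix_order_le_max.
have rE : (x, y) \in iter (fix_order cop_step (x, y)) cop_step finset.set0.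
  by rewrite in_iter_fix_orderE ?FT ?inE //; exact: cop_step_mono.
rewrite [phi (x, y)]/phi; case: (fix_order _ _) rM rE => [|n] nM; first by rewrite inE.
rewrite /= inE /= (negbTE xy) /= => /forall_inP.
(* Ignored robber moves count as staying, which the classical game also allows. *)
set y' := if v \in cl_nbhd y then v else y.
have yy' : y' \in cl_nbhd y by rewrite /y'; case: ifPn => // _; rewrite inE eqxx.
move=> /(_ y' yy')/exists_inP[x' xx' x'y'].
set d := c (M - n.+1)%N + 1.
suff : mean s (fun u => phi (if [&& u \in cl_nbhd x, v \in cl_nbhd y, u == y & v == x]
    then (u, u) else (if u \in cl_nbhd x then u else x, y'))) <= c M - d.
  by rewrite /d; lra.
apply: (sP x') => [u|]; first exact: phiM.
have -> : d * k = c (M - n)%N by rewrite -(subnSK nM) /= mulrC.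
rewrite lerD2l lerN2 cle // leq_sub2l // xx' /=.
case: ifPn => _; last exact: (fix_order_small cop_step_mono).
(* An en passant capture ends on the diagonal, of rank at most 1; [n = 0] is excluded, as [(x', y')]
   would lie in the empty set. *)
apply: (fix_order_small cop_step_mono).
by case: n x'y' {nM d} => [|n _]; rewrite ?inE //= eqxx.
Qed.

End OneCop.

(** * Value and optimality *)

Section Solution.
Variables (R : realType) (G : sgraph).
Local Notation pos := (G * G)%type.

Lemma cops_win_of_cop_number : cop_number G = 1%N -> cops_win G 1.
Proof.
by rewrite /cop_number; case: ex_minnP => m /asboolP mG _ <-.
Qed.

Local Open Scope ereal_scope.

Lemma cop_guarantee_le (sC : strategy R G) p (v : \bar R) :
  (forall sR, payoff sC sR p <= v) -> cop_guarantee sC p <= v.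
Proof. by move=> H; apply: ge_ereal_sup => _ [sR _ <-]. Qed.

Lemma robber_guarantee_ge (sR : strategy R G) p (v : \bar R) :
  (forall sC, v <= payoff sC sR p) -> v <= robber_guarantee sR p.
Proof. by move=> H; apply: le_ereal_inf_tmp => _ [sC _ <-]. Qed.

Lemma guarantee_le (sC sR : strategy R G) p :
  robber_guarantee sR p <= cop_guarantee sC p.
Proof.
apply: (@le_trans _ _ (payoff sC sR p)).
  by apply: ereal_inf_lbound; exists sC.
by apply: ereal_sup_ubound; exists sR.
Qed.

Lemma lower_upper_value (p : pos) : lower_value R p <= upper_value R p.
Proof.
apply: ge_ereal_sup => _ [sR _ <-]; apply: le_ereal_inf_tmp => _ [sC _ <-].
exact: guarantee_le.
Qed.

Lemma concurrent_game_solution :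
  exists (V : pos -> \bar R) (sC : pos -> fdist R G) (w : nat -> pos -> R)
    (sR : nat -> pos -> fdist R G),
  [/\ forall p, 0 <= V p,
      forall p, cop_guarantee (fun _ => sC) p <= V p,
      forall n p, (w n p)%:E <= robber_guarantee (fun _ => sR n) p,
      forall m n p, (m <= n)%N -> (w m p <= w n p)%R &
      forall p, V p = ereal_sup (range (fun n => (w n p)%:E))].
Proof.
have [w [s [t [w0 wle ws wt]]]] := value_iteration R G.
have [s' s'P] := cop_limit w0 wle ws.
exists (fun p => ereal_sup (range (fun n => (w n p)%:E))), s', w, t.
split=> // [p|p|n p].
- apply: (@le_trans _ _ (w 0%N p)%:E); first by rewrite lee_fin.
  by apply: ereal_sup_ubound; exists 0%N.
- set V := ereal_sup _.
  have wV n : (w n p)%:E <= V by apply: ereal_sup_ubound; exists n.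
  apply: cop_guarantee_le => sR; case: V wV => [C wV|_|/(_ 0%N)//]; last exact: leey.
  by apply: payoff_le => n; apply: cop_partial_sum_le wle w0 s'P _ _ _ _ _ wV.
- apply: robber_guarantee_ge => sC.
  exact: robber_payoff_ge (discount_ge0 R n) (discount_lt1 R n) (w0 n) (wt n) sC p.
Qed.

Lemma one_cop_upper_value : connected_graph G -> cop_number G = 1%N ->
  forall p : pos, upper_value R p < +oo.
Proof.
move=> G_connected /cops_win_of_cop_number /(cop_win_everywhere G_connected).
move=> /(one_cop_potential R)[s [phi [phi0 phiP]]] p.
apply: (@le_lt_trans _ _ (phi p)%:E); last exact: ltry.
apply: (@le_trans _ _ (cop_guarantee (fun _ _ => s) p)).
  by apply: ereal_inf_lbound; exists (fun _ _ => s).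
apply: cop_guarantee_le => sR; apply: payoff_le => n.
(* The potential enters as a constant sequence, with [phi p] itself as upper bound. *)
apply: (@cop_partial_sum_le R G (fun=> phi) (fun=> s)) => // q C qC _ v.
exact: le_trans (phiP q v) (qC 0%N).
Qed.

(** Take [w n] above [eps^-1] or [V - eps], according to whether [V] is infinite. Allowing every [v]
    from [w n] to [V] makes later stages work too, hence one stage for all positions. *)
Lemma eps_close_approx (V : \bar R) (w : nat -> R) (eps : R) : (0 < eps)%R -> 0 <= V ->
    V = ereal_sup (range (fun n => (w n)%:E)) ->
  exists n, forall v, (w n)%:E <= v -> v <= V -> eps_close eps V v.
Proof.
move=> e0 V0 VE; have e0' : eps != 0%R by rewrite gt_eqF.
have [n wn] : exists n, (if V == +oo then eps^-1%:E else V - eps%:E) < (w n)%:E.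
  suff /ereal_sup_gt[_ [n _ <-]] :
      (if V == +oo then eps^-1%:E else V - eps%:E) < ereal_sup (range (fun n => (w n)%:E)).
    by exists n.
  rewrite -VE; case: V {VE} V0 => [r _| |] //=; last by rewrite ltry.
  by rewrite -EFinB lte_fin ltrBlDr ltrDl.
exists n => v wv vV; move: wn; rewrite /eps_close; case: eqP => [_|/eqP VNoo] wn.
  by rewrite inver (negbTE e0') (le_trans (ltW wn)).
have vw := lt_le_trans wn wv.
case: V V0 VNoo vV vw {wn VE} => [r _ _| |] //; case: v {wv} => [x| |] //.
rewrite -!EFinB !lee_fin lte_fin => xr rx.
by rewrite ger0_norm ?subr_ge0 // lerBlDr addrC -lerBlDr ltW.
Qed.

End Solution.

Theorem theorem4p4 (R : realType) (G : sgraph) (G_connected : connected_graph G) :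
  [/\ forall x y : G, has_value R (x, y),
      (exists2 sC : strategy R G, memoryless sC &
         forall x y : G, cop_eps_optimal 0 sC (x, y)) /\
      (forall eps : R, 0 < eps ->
         exists2 sR : strategy R G, memoryless sR &
           forall x y : G, robber_eps_optimal eps sR (x, y)),
      finite_positions R G `|` infinite_positions R G = [set: G * G] /\
      finite_positions R G `&` infinite_positions R G = set0 &
      cop_number G = 1%N -> finite_positions R G = [set: G * G] ].
Proof.
have [V [sC [w [sR [V0 sCV wsR wle VE]]]]] := concurrent_game_solution R G.
have upper_le p : (upper_value R p <= cop_guarantee (fun _ => sC) p)%E.
  by apply: ereal_inf_lbound; exists (fun _ => sC).
have le_lower p : (V p <= lower_value R p)%E.
  rewrite VE; apply: ge_ereal_sup => _ [n _ <-]; apply: le_trans (wsR n p) _.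
  by apply: ereal_sup_ubound; exists (fun _ => sR n).
have valueE p : value R p = V p.
  apply/le_anti/andP; split; first exact: le_trans (upper_le p) (sCV p).
  exact: le_trans (le_lower p) (lower_upper_value R p).
have copE p : cop_guarantee (fun _ => sC) p = V p.
  by apply/le_anti; rewrite sCV -valueE upper_le.
split.
- move=> x y; apply/le_anti/andP; split; last exact: lower_upper_value.
  exact: le_trans (le_trans (upper_le _) (sCV _)) (le_lower _).
- split; first exists (fun _ => sC) => // x y.
    rewrite /cop_eps_optimal valueE copE /eps_close.
    case: (V (x, y)) (V0 (x, y)) => [r _|_|] //=; last by rewrite leey.
    by rewrite subrr normr0.
  move=> eps e0.
  have /choice[n nP] p := eps_close_approx e0 (V0 p) (VE p).
  pose N := \max_p n p; exists (fun _ => sR N) => // x y.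
  rewrite /robber_eps_optimal valueE; apply: nP.
    by apply: le_trans (wsR N _); rewrite lee_fin wle // /N leq_bigmax.
  by rewrite -copE guarantee_le.
- split; apply/seteqP; split=> p //=.
    move=> _; have [Voo|Voo] := eqVneq (value R p) +oo%E; [by right|left].
    by rewrite /finite_positions /= ltey.
  by move=> [+ Voo]; rewrite /finite_positions /= Voo ltxx.
- move=> cG; apply/seteqP; split=> // p _.
  exact: one_cop_upper_value.
Qed.
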